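(* Assume that $\mathcal{E}$ is an evolution algebra over a domain $D$ with a finite natural basis $\{e_i\}_{i\in I}$. Let $\omega_i^j\in D$ be the structure constants, that is, $e_i^2=\sum_j\omega_i^je_j$. Then: (1) $\mathcal{E}^2=\mathcal{E}$ if and only if the matrix $(\omega_i^j)$ is invertible (over $D$). Moreover, in this case, for any other natural basis $\{f_i\}_{i\in I}$ of $\mathcal{E}$ there is a permutation $\sigma$ of $I$ such that $f_i=k_ie_{\sigma(i)}$ with each $k_i\in D^\times$. (2) $\mathcal{E}$ is quasiperfect if and only if the determinant of $(\omega_i^j)$ is nonzero. As before, in this case, for any other natural basis $\{f_i\}_{i\in I}$ of $\mathcal{E}$ there is a permutation $\sigma$ of $I$ such that $f_i=k_ie_{\sigma(i)}$ with each $k_i\in D^\times$.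
   Context: A domain is a commutative (unital) ring in which $xy=0$ implies $x=0$ or $y=0$; $D^\times$ is its group of invertible elements. A $D$-algebra is a $D$-module with a $D$-bilinear product (not necessarily associative or unital). An evolution algebra over $D$ is a $D$-algebra that is free as a $D$-module and has a basis (natural basis) such that the product of any two different basis elements is zero. $\mathcal{E}^2$ is the $D$-span of all products of two elements. With $Q$ the field of fractions of $D$ and $\mathcal{E}_Q$ the scalar extension (algebra of fractions $\frac{a}{d}$, $a\in\mathcal{E}$, $0\ne d\in D$), $\mathcal{E}$ is quasiperfect if $\mathcal{E}_Q^2=\mathcal{E}_Q$. *)

(* Defs.v *)
From HB Require Import structures.
From mathcomp Require Import all_boot all_algebra.
From mathcomp Require Import boolp ring.

Set Implicit Arguments.
Unset Strict Implicit.
Unset Printing Implicit Defensive.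

Import GRing.Theory.
Local Open Scope ring_scope.
Local Open Scope quotient_scope.

(* A (nonassociative, nonunital) algebra over R is an R-module V together with
   a product mu : {bilinear V -> V -> V}. *)

Section NonassociativeAlgebra.
Variables (R : comNzRingType) (V : lmodType R) (mu : {bilinear V -> V -> V}).

Definition in_square (x : V) : Prop :=
  exists (n : nat) (c : 'I_n -> R) (a b : 'I_n -> V),
    x = \sum_(k < n) c k *: mu (a k) (b k).

Definition square_full : Prop := forall x : V, in_square x.

Definition is_basis (I : finType) (e : I -> V) : Prop :=
  (forall x : V, exists c : I -> R, x = \sum_i c i *: e i) /\
  (forall c : I -> R, \sum_i c i *: e i = 0 -> forall i, c i = 0).

Definition natural_basis (I : finType) (e : I -> V) : Prop :=
  is_basis e /\ (forall i j : I, i != j -> mu (e i) (e j) = 0).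

Definition structure_constants (I : finType) (e : I -> V) (w : I -> I -> R) :
  Prop := forall i, mu (e i) (e i) = \sum_j w i j *: e j.

End NonassociativeAlgebra.

(* enum_val : 'I_#|I| -> I is the bijection given by the enumeration of I. *)
Definition matrix_of_family (R : Type) (I : finType) (w : I -> I -> R) :
  'M[R]_#|I| := \matrix_(i, j) w (enum_val i) (enum_val j).

Section ModuleOfFractions.
Variables (D : idomainType) (E : lmodType D).

Local Notation nonzero := {d : D | d != 0}.

Definition nonzero1 : nonzero := exist _ 1 (oner_neq0 D).
Definition nonzeroM (d d' : nonzero) : nonzero :=
  exist _ (sval d * sval d') (mulf_neq0 (valP d) (valP d')).

(* The factor s is the usual one in a localization; it is redundant when E is
   torsion-free, in particular when E is free. *)
Definition frac_equiv (x y : E * nonzero) : bool :=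
  `[< exists2 s : D, s != 0 &
        s *: (sval y.2 *: x.1) = s *: (sval x.2 *: y.1) >].

Lemma frac_equiv_refl : reflexive frac_equiv.
Proof. by move=> x; apply/asboolP; exists 1; rewrite ?oner_neq0. Qed.

Lemma frac_equiv_sym : symmetric frac_equiv.
Proof. by move=> x y; apply/asboolP/asboolP => -[s s0 /esym xy]; exists s. Qed.

Lemma frac_equiv_trans : transitive frac_equiv.
Proof.
move=> [b q] [a p] [c r] /asboolP[s s0 /= ab] /asboolP[t t0 /= bc].
apply/asboolP; exists (s * t * sval q).
  by rewrite !mulf_neq0 // (valP q).
rewrite /= !scalerA in ab bc *.
have -> : s * t * sval q * sval r = t * sval r * (s * sval q) by ring.
rewrite -scalerA ab scalerA.
have -> : t * sval r * (s * sval p) = s * sval p * (t * sval r) by ring.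
by rewrite -scalerA bc scalerA; congr (_ *: _); ring.
Qed.

Canonical frac_equiv_equiv :=
  EquivRel frac_equiv frac_equiv_refl frac_equiv_sym frac_equiv_trans.

(* The carrier of E_Q: the fractions a / d with a in E and d <> 0 in D. *)
Definition fracmod : Type := {eq_quot frac_equiv}.
HB.instance Definition _ : EqQuotient _ frac_equiv fracmod :=
  EqQuotient.on fracmod.
HB.instance Definition _ := Choice.on fracmod.

Definition mfrac (a : E) (d : nonzero) : fracmod := \pi_fracmod (a, d).

Lemma mfracP a d b c :
  mfrac a d = mfrac b c <->
  exists2 s : D, s != 0 & s *: (sval c *: a) = s *: (sval d *: b).
Proof. by split=> [/eqmodP/asboolP|H] //; apply/eqmodP/asboolP. Qed.

Lemma mfrac_elim (P : fracmod -> Prop) :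
  (forall a d, P (mfrac a d)) -> forall u, P u.
Proof. by move=> H; elim/quotW => -[a d]; apply: H. Qed.

Lemma mfrac_repr u : mfrac (repr u).1 (repr u).2 = u.
Proof. by rewrite /mfrac -surjective_pairing reprK. Qed.

Lemma mfrac_reprE a d :
  exists2 s : D, s != 0 &
    s * sval d *: (repr (mfrac a d)).1 = s * sval (repr (mfrac a d)).2 *: a.
Proof.
have /mfracP[s s0 H] := mfrac_repr (mfrac a d).
by exists s; rewrite // -!scalerA.
Qed.

Definition fmadd (u v : fracmod) : fracmod :=
  let: (a, d) := repr u in let: (b, c) := repr v in
  mfrac (sval c *: a + sval d *: b) (nonzeroM d c).

Definition fmopp (u : fracmod) : fracmod :=
  let: (a, d) := repr u in mfrac (- a) d.

Lemma ratio_denom_neq0 (r : {ratio D}) : \d_r != 0.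
Proof. exact: denom_ratioP. Qed.

Definition fmscale (x : {fraction D}) (u : fracmod) : fracmod :=
  let: (a, d) := repr u in
  mfrac (\n_(repr x) *: a)
    (nonzeroM (exist _ \d_(repr x) (ratio_denom_neq0 _)) d).

Lemma fmaddE a d b c :
  fmadd (mfrac a d) (mfrac b c) =
  mfrac (sval c *: a + sval d *: b) (nonzeroM d c).
Proof.
rewrite /fmadd; have [s s0] := mfrac_reprE a d; have [t t0] := mfrac_reprE b c.
case: (repr (mfrac a d)) => a' d'; case: (repr (mfrac b c)) => b' c' /= Hb Ha.
apply/mfracP; exists (s * t); rewrite ?mulf_neq0 //= !scalerDr !scalerA.
congr (_ + _).
- have -> : s * t * (sval d * sval c) * sval c' =
            t * sval c * sval c' * (s * sval d) by ring.
  by rewrite -scalerA Ha scalerA; congr (_ *: _); ring.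
- have -> : s * t * (sval d * sval c) * sval d' =
            s * sval d * sval d' * (t * sval c) by ring.
  by rewrite -scalerA Hb scalerA; congr (_ *: _); ring.
Qed.

Lemma fmoppE a d : fmopp (mfrac a d) = mfrac (- a) d.
Proof.
rewrite /fmopp; have [s s0] := mfrac_reprE a d.
case: (repr (mfrac a d)) => a' d' /= Ha.
by apply/mfracP; exists s; rewrite //= !scalerN !scalerA Ha.
Qed.

Lemma fmscaleE (r : {ratio D}) a d :
  fmscale (\pi_({fraction D}) r) (mfrac a d) =
  mfrac (\n_r *: a) (nonzeroM (exist _ \d_r (ratio_denom_neq0 r)) d).
Proof.
rewrite /fmscale; have [s s0] := mfrac_reprE a d.
case: (repr (mfrac a d)) => a' d' /= Ha.
apply/mfracP; exists s => //=; rewrite !scalerA.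
have Hr := FracField.equivf_l r.
set r' := repr _ in Hr *.
have -> : s * (\d_r * sval d) * \n_r' = \n_r' * \d_r * (s * sval d) by ring.
by rewrite -[LHS]scalerA Ha scalerA Hr; congr (_ *: _); ring.
Qed.

Lemma mfrac_eq a d b c : sval c *: a = sval d *: b -> mfrac a d = mfrac b c.
Proof. by move=> H; apply/mfracP; exists 1; rewrite ?oner_neq0 // H. Qed.

Let fmaddA : associative fmadd.
Proof.
elim/mfrac_elim=> a d; elim/mfrac_elim=> b c; elim/mfrac_elim=> x y.
rewrite !fmaddE; apply: mfrac_eq; rewrite /= !scalerDr !scalerA !addrA.
by congr (_ *: _ + _ *: _ + _ *: _); ring.
Qed.

Let fmaddC : commutative fmadd.
Proof.
elim/mfrac_elim=> a d; elim/mfrac_elim=> b c; rewrite !fmaddE addrC.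
by apply: mfrac_eq; rewrite /= (mulrC (sval c)).
Qed.

Let fmadd0 : left_id (mfrac 0 nonzero1) fmadd.
Proof.
elim/mfrac_elim=> a d; rewrite fmaddE; apply: mfrac_eq.
by rewrite /= scaler0 add0r scale1r mul1r.
Qed.

Let fmaddN : left_inverse (mfrac 0 nonzero1) fmopp fmadd.
Proof.
elim/mfrac_elim=> a d; rewrite fmoppE fmaddE; apply: mfrac_eq.
by rewrite /= scalerN addNr !scaler0.
Qed.

HB.instance Definition _ :=
  GRing.isZmodule.Build fracmod fmaddA fmaddC fmadd0 fmaddN.

Let fmscaleA x y u : fmscale x (fmscale y u) = fmscale (x * y) u.
Proof.
elim/mfrac_elim: u => a d; elim/quotW: x => x; elim/quotW: y => y.
have -> : \pi_({fraction D}) x * \pi_({fraction D}) y =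
          \pi_({fraction D}) (FracField.mulf x y).
  by rewrite (FracField.pi_mul x y).
rewrite !fmscaleE; apply: mfrac_eq.
rewrite /= /FracField.mulf !numden_Ratio ?mulf_neq0 ?denom_ratioP //.
by rewrite !scalerA; congr (_ *: _); ring.
Qed.

Let fmscale1 : left_id 1 fmscale.
Proof.
elim/mfrac_elim=> a d.
have -> : 1 = \pi_({fraction D}) (Ratio 1 1).
  by rewrite -tofrac1; unlock FracField.tofrac.
rewrite fmscaleE; apply: mfrac_eq.
by rewrite /= !numden_Ratio ?oner_neq0 // mul1r scale1r.
Qed.

Let fmscaleDr : right_distributive fmscale +%R.
Proof.
move=> x; elim/mfrac_elim=> a d; elim/mfrac_elim=> b c; elim/quotW: x => x.
rewrite [in LHS]/GRing.add /= fmaddE !fmscaleE [in RHS]/GRing.add /= fmaddE.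
apply: mfrac_eq; rewrite /= !scalerDr !scalerA.
by congr (_ *: _ + _ *: _); ring.
Qed.

Let fmscaleDl u : {morph fmscale^~ u : x y / x + y}.
Proof.
elim/mfrac_elim: u => a d; elim/quotW=> x; elim/quotW=> y.
have -> : \pi_({fraction D}) x + \pi_({fraction D}) y =
          \pi_({fraction D}) (FracField.addf x y).
  by rewrite (FracField.pi_add x y).
rewrite !fmscaleE [in RHS]/GRing.add /= fmaddE; apply: mfrac_eq.
rewrite /= /FracField.addf !numden_Ratio ?mulf_neq0 ?denom_ratioP //.
by rewrite !scalerA -scalerDl !scalerA; congr (_ *: _); ring.
Qed.

HB.instance Definition _ := GRing.Zmodule_isLmodule.Build {fraction D} fracmod
  fmscaleA fmscale1 fmscaleDr fmscaleDl.

Lemma mfracD a d b c :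
  mfrac a d + mfrac b c = mfrac (sval c *: a + sval d *: b) (nonzeroM d c).
Proof. exact: fmaddE. Qed.

Lemma mfracZ (r : {ratio D}) a d :
  \pi_({fraction D}) r *: mfrac a d =
  mfrac (\n_r *: a) (nonzeroM (exist _ \d_r (ratio_denom_neq0 r)) d).
Proof. exact: fmscaleE. Qed.

Lemma mfracE a d :
  mfrac a d = (FracField.tofrac (sval d))^-1 *: mfrac a nonzero1.
Proof.
have d0 : FracField.tofrac (sval d) != 0.
  by rewrite -tofrac0 tofrac_eq (valP d).
apply: (scalerI d0); rewrite scalerA divff // scale1r.
have -> : FracField.tofrac (sval d) = \pi_({fraction D}) (Ratio (sval d) 1).
  by unlock FracField.tofrac.
rewrite mfracZ; apply: mfrac_eq.
by rewrite /= !numden_Ratio ?oner_neq0 // !mul1r scale1r.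
Qed.

Section Product.
Variable mu : {bilinear E -> E -> E}.

Definition fracmul (u v : fracmod) : fracmod :=
  let: (a, d) := repr u in let: (b, c) := repr v in
  mfrac (mu a b) (nonzeroM d c).

Lemma fracmulE a d b c :
  fracmul (mfrac a d) (mfrac b c) = mfrac (mu a b) (nonzeroM d c).
Proof.
rewrite /fracmul; have [s s0] := mfrac_reprE a d.
have [t t0] := mfrac_reprE b c.
case: (repr (mfrac a d)) => a' d'; case: (repr (mfrac b c)) => b' c' /= Hb Ha.
apply/mfracP; exists (s * t); rewrite ?mulf_neq0 //= !scalerA.
have -> : s * t * (sval d * sval c) = s * sval d * (t * sval c) by ring.
rewrite -[LHS]scalerA -linearZr_LR Hb -linearZl_LR Ha.
by rewrite linearZl_LR linearZr_LR !scalerA; congr (_ *: _); ring.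
Qed.

Let fracmul_bilinear : bilinear_for *:%R *:%R fracmul.
Proof.
split.
- move=> w x; elim/mfrac_elim=> a d; elim/mfrac_elim=> b c.
  elim/mfrac_elim: w => e f; elim/quotW: x => x.
  rewrite /= mfracZ mfracD !fracmulE mfracZ mfracD; apply: mfrac_eq => /=.
  rewrite linearDl !linearZl_LR !scalerDr !scalerA.
  by congr (_ *: _ + _ *: _); ring.
- move=> w x; elim/mfrac_elim=> a d; elim/mfrac_elim=> b c.
  elim/mfrac_elim: w => e f; elim/quotW: x => x.
  rewrite /= mfracZ mfracD !fracmulE mfracZ mfracD; apply: mfrac_eq => /=.
  rewrite linearDr !linearZr_LR !scalerDr !scalerA.
  by congr (_ *: _ + _ *: _); ring.
Qed.

HB.instance Definition _ :=
  bilinear_isBilinear.Build {fraction D} fracmod fracmod fracmod *:%R *:%R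
    fracmul fracmul_bilinear.

Definition quasiperfect : Prop := square_full fracmul.

End Product.

End ModuleOfFractions.

(* Main.v *)
Require Import Defs.
From mathcomp Require Import all_boot all_algebra perm.
From mathcomp Require Import boolp ring.

Set Implicit Arguments.
Unset Strict Implicit.
Unset Printing Implicit Defensive.

Import GRing.Theory.
Local Open Scope ring_scope.

(** Everything rests on the product of two combinations of a natural basis e
being diagonal: the product of sum a_i e_i and sum b_i e_i is
sum (a_i b_i) e_i^2.

Hence the span of all products is the span of the squares e_i^2, whose
coordinates in e are the rows of W = (w_i^j). It is the whole algebra exactly
when every e_i is a combination of these rows, that is, when W has a left
inverse, and a left inverse of a square matrix over a commutative ring is an
inverse ([square_full_unitmx]). This holds over any commutative ring. Scalar
extension turns e into a natural basis of E_Q with structure matrix the image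
of W ([natural_basis_incl], [structure_constants_incl]), and over the field Q
being invertible means having a nonzero determinant, so the criterion for
quasiperfection follows ([quasiperfect_det]).

For uniqueness ([natural_basis_unique]), a nonzero determinant is enough. If
f_i = sum_j A_ij e_j is another natural basis and i <> k, then
0 = f_i f_k = sum_j (A_ij A_kj) e_j^2, and the e_j^2 are linearly independent,
so that A_ij A_kj = 0 for every j: each column of A has at most one nonzero
entry. No row of A vanishes, so choosing a nonzero entry in each row gives an
injection of I into I, hence a permutation, and all other entries of A are 0.
Each remaining entry is a unit because f spans e. *)

(** * Matrices indexed by a finite type *)

Lemma sum_pick (R : nzRingType) (V : lmodType R) (I : finType) (e : I -> V)
    (i : I) :
  \sum_j (i == j)%:R *: e j = e i.
Proof.
rewrite (bigD1 i) //= eqxx scale1r big1 ?addr0 // => j ji.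
by rewrite eq_sym (negPf ji) scale0r.
Qed.

Lemma reindex_enum_val (V : nmodType) (I : finType) (F : I -> V) :
  \sum_(k < #|I|) F (enum_val k) = \sum_i F i.
Proof. by rewrite [RHS]big_enum_val. Qed.

Section FamilyMatrix.
Variables (R : comNzRingType) (I : finType).

Lemma matrix_of_familyM (a b : I -> I -> R) :
  matrix_of_family a *m matrix_of_family b =
  matrix_of_family (fun i k => \sum_j a i j * b j k).
Proof.
apply/matrixP => i k; rewrite !mxE.
rewrite -(reindex_enum_val (fun j => a _ j * b j _)).
by apply: eq_bigr => j _; rewrite !mxE.
Qed.

Lemma matrix_of_family1 :
  matrix_of_family (fun i j : I => (i == j)%:R) = 1%:M :> 'M[R]_#|I|.
Proof. by apply/matrixP => i j; rewrite !mxE (inj_eq enum_val_inj). Qed.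

Lemma matrix_of_familyE (M : 'M[R]_#|I|) :
  matrix_of_family (fun i j => M (enum_rank i) (enum_rank j)) = M.
Proof. by apply/matrixP => i j; rewrite !mxE !enum_valK. Qed.

End FamilyMatrix.

Lemma map_matrix_of_family (R S : nzRingType) (g : {rmorphism R -> S})
    (I : finType) (w : I -> I -> R) :
  map_mx g (matrix_of_family w) = matrix_of_family (fun i j => g (w i j)).
Proof. by apply/matrixP => i j; rewrite !mxE. Qed.

(** Linear independence of the rows of w, which is how a nonzero determinant is
used over a domain that need not be a field. *)
Lemma row_relation_eq0 (D : idomainType) (I : finType) (w : I -> I -> D)
    (c : I -> D) :
  \det (matrix_of_family w) != 0 ->
  (forall l, \sum_j c j * w j l = 0) -> forall j, c j = 0.
Proof.
move=> dw cw j; apply/eqP; apply: contraNT dw => cj.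
apply/det0P; exists (\row_k c (enum_val k)).
  apply: contraNneq cj => /rowP/(_ (enum_rank j)).
  by rewrite !mxE enum_rankK => ->.
apply/rowP => l; rewrite !mxE -[RHS](cw (enum_val l)).
rewrite -(reindex_enum_val (fun j => c j * w j _)).
by apply: eq_bigr => k _; rewrite !mxE.
Qed.

(** * Products and squares in a natural basis *)

Section Bases.
Variables (R : comNzRingType) (V : lmodType R) (mu : {bilinear V -> V -> V}).
Variables (I : finType) (e : I -> V).

Lemma basis_coef_inj (a b : I -> R) :
  is_basis e -> \sum_i a i *: e i = \sum_i b i *: e i -> a =1 b.
Proof.
move=> [_ e_free] ab i; apply: subr0_eq; apply: e_free (fun i => a i - b i) _ i.
by under eq_bigr do rewrite scalerBl; rewrite sumrB ab subrr.
Qed.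

Lemma natural_mulE (a b : I -> R) :
  natural_basis mu e ->
  mu (\sum_i a i *: e i) (\sum_j b j *: e j) =
  \sum_i (a i * b i) *: mu (e i) (e i).
Proof.
move=> [_ e_orth]; rewrite linear_sumlz; apply: eq_bigr => i _.
rewrite linear_sumr (bigD1 i) //= big1 ?addr0 => [|j ji].
  by rewrite linearZl_LR linearZr_LR scalerA.
by rewrite linearZl_LR linearZr_LR e_orth 1?eq_sym // !scaler0.
Qed.

Lemma structure_sumE (w : I -> I -> R) (c : I -> R) :
  structure_constants mu e w ->
  \sum_i c i *: mu (e i) (e i) = \sum_l (\sum_i c i * w i l) *: e l.
Proof.
move=> hw; under eq_bigr => i _ do rewrite hw scaler_sumr.
rewrite exchange_big; apply: eq_bigr => l _; rewrite scaler_suml.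
by apply: eq_bigr => i _; rewrite scalerA.
Qed.

(** Products of pairs are combinations of the squares of the natural basis
because mixed products vanish. *)
Lemma in_square_natural (x : V) :
  natural_basis mu e -> in_square mu x ->
  exists c : I -> R, x = \sum_i c i *: mu (e i) (e i).
Proof.
move=> he [n [c [a [b ->]]]].
have [e_span _] := he.1.
have [ca caE] := choice (fun k => e_span (a k)).
have [cb cbE] := choice (fun k => e_span (b k)).
exists (fun i => \sum_(k < n) c k * (ca k i * cb k i)).
under eq_bigr => k _.
  rewrite caE cbE natural_mulE // scaler_sumr.
  over.
rewrite exchange_big; apply: eq_bigr => i _; rewrite scaler_suml.
by apply: eq_bigr => k _; rewrite scalerA.
Qed.

Lemma in_square_sum (c : I -> R) (a b : I -> V) :
  in_square mu (\sum_i c i *: mu (a i) (b i)).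
Proof.
exists #|I|, (c \o enum_val), (a \o enum_val), (b \o enum_val).
by rewrite -(reindex_enum_val (fun i => c i *: mu (a i) (b i))).
Qed.

End Bases.

(** * The criterion for a full square *)

(** The rows of w are the coordinates of the squares e_i^2, which span the
square of the algebra; writing each e_i in terms of them is a left inverse of
the matrix. No division is involved, so a commutative ring suffices. *)
Lemma square_full_unitmx (R : comUnitRingType) (V : lmodType R)
    (mu : {bilinear V -> V -> V}) (I : finType) (e : I -> V)
    (w : I -> I -> R) :
  natural_basis mu e -> structure_constants mu e w ->
  square_full mu <-> matrix_of_family w \in unitmx.
Proof.
move=> he hw; split=> [full | wU].
- have [B BE] := choice (fun i => in_square_natural he (full (e i))).
  suff /mulmx1_unit[] : matrix_of_family B *m matrix_of_family w = 1%:M by [].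
  rewrite matrix_of_familyM -matrix_of_family1; congr matrix_of_family.
  apply/funext => i; apply/funext; apply: basis_coef_inj he.1 _.
  by rewrite sum_pick -(structure_sumE _ hw) -BE.
- set B := fun i j => invmx (matrix_of_family w) (enum_rank i) (enum_rank j).
  have Bw i l : \sum_j B i j * w j l = (i == l)%:R.
    have := mulVmx wU; rewrite -[invmx _]matrix_of_familyE matrix_of_familyM.
    move=> /matrixP/(_ (enum_rank i) (enum_rank l)).
    by rewrite !mxE !enum_rankK (inj_eq enum_rank_inj).
  have eE i : e i = \sum_j B i j *: mu (e j) (e j).
    rewrite (structure_sumE _ hw) -[LHS](sum_pick e).
    by apply: eq_bigr => l _; rewrite Bw.
  move=> x; have [c ->] := he.1.1 x.
  have -> : \sum_i c i *: e i =
            \sum_j (\sum_i c i * B i j) *: mu (e j) (e j).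
    under eq_bigr => i _ do rewrite eE scaler_sumr.
    rewrite exchange_big; apply: eq_bigr => j _; rewrite scaler_suml.
    by apply: eq_bigr => i _; rewrite scalerA.
  exact: in_square_sum.
Qed.

(** * Uniqueness of the natural basis *)

(** The base change matrix A is monomial: orthogonality of f and independence
of the squares of e leave at most one nonzero entry in each column, and no row
is zero. *)
Lemma natural_basis_unique (D : idomainType) (E : lmodType D)
    (mu : {bilinear E -> E -> E}) (I : finType) (e f : I -> E)
    (w : I -> I -> D) :
  natural_basis mu e -> structure_constants mu e w ->
  \det (matrix_of_family w) != 0 -> natural_basis mu f ->
  exists (s : {perm I}) (k : I -> D),
    forall i, k i \is a GRing.unit /\ f i = k i *: e (s i).
Proof.
move=> he hw dw hf.
have [A fE] := choice (fun i => he.1.1 (f i)).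
have A_col i k : i != k -> forall j, A i j * A k j = 0.
  move=> ik; apply: (row_relation_eq0 dw); apply: (he.1.2).
  by rewrite -(structure_sumE _ hw) -natural_mulE // -!fE hf.2.
have A_row i : exists j, A i j != 0.
  apply/existsP; apply: contraT; rewrite negb_exists => /forallP A0.
  have f0 : f i = 0.
    by rewrite fE big1 // => j _; rewrite (eqP (negbNE (A0 j))) scale0r.
  have /(_ _ i)/eqP := hf.1.2 (fun j => (i == j)%:R).
  by rewrite sum_pick f0 eqxx oner_eq0 => /(_ erefl).
have [s As] := choice A_row.
have s_inj : injective s.
  move=> i k sik; apply/eqP; apply: contraT => /A_col/(_ (s i))/eqP.
  by rewrite mulf_eq0 {2}sik !(negPf (As _)).
have fsE i : f i = A i (s i) *: e (s i).
  rewrite fE (bigD1 (s i)) //= big1 ?addr0 // => j.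
  (* s is onto, so column j already has its nonzero entry in row s^-1 j. *)
  rewrite -[j](f_invF s_inj) (inj_eq s_inj) eq_sym.
  move=> /A_col/(_ (s (invF s_inj j))).
  by move=> /eqP; rewrite mulf_eq0 (negPf (As _)) orbF => /eqP ->; rewrite scale0r.
exists (perm s_inj), (fun i => A i (s i)) => i; rewrite permE; split=> //.
have [c cE] := hf.1.1 (e (s i)).
(* Compare the coordinates of f i in the basis f itself. *)
have kc : (fun j => (i == j)%:R) =1 (fun j => A i (s i) * c j).
  apply: basis_coef_inj hf.1 _; rewrite sum_pick fsE cE scaler_sumr.
  by apply: eq_bigr => j _; rewrite scalerA.
by apply/unitrPr; exists (c i); rewrite -kc eqxx.
Qed.

(** * Scalar extension to the field of fractions *)

Section Fractions.
Variables (D : idomainType) (E : lmodType D).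

Local Notation "x %:F" := (FracField.tofrac x).
Local Notation incl a := (mfrac a (Defs.nonzero1 D)).

Lemma tofrac_pi (d : D) : d%:F = \pi_({fraction D})%qT (Ratio d 1).
Proof. by unlock FracField.tofrac. Qed.

Lemma inclZ (d : D) (a : E) : incl (d *: a) = d%:F *: incl a.
Proof.
rewrite tofrac_pi mfracZ; apply: mfrac_eq.
by rewrite /= !numden_Ratio ?oner_neq0 // !mul1r.
Qed.

Lemma inclD (a b : E) : incl (a + b) = incl a + incl b.
Proof. by rewrite mfracD; apply: mfrac_eq; rewrite /= !scale1r mulr1 scale1r. Qed.

Lemma incl0 : incl (0 : E) = 0.
Proof. by []. Qed.

Lemma incl_sum (I : finType) (c : I -> D) (e : I -> E) :
  incl (\sum_i c i *: e i) = \sum_i (c i)%:F *: incl (e i).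
Proof.
rewrite (big_morph (fun a => incl a) inclD incl0).
by apply: eq_bigr => i _; rewrite inclZ.
Qed.

(** Inclusion in the module of fractions kills only torsion; this is how
freeness over the domain passes to the fractions. *)
Lemma incl_eq0 (a : E) : incl a = 0 -> exists2 s : D, s != 0 & s *: a = 0.
Proof.
rewrite -incl0 => /mfracP[s s0]; rewrite /= scaler0 scale1r => sa.
by exists s; rewrite // sa scaler0.
Qed.

Lemma tofrac_denom (x : {fraction D}) :
  exists p : D * D, p.2 != 0 /\ x = p.1%:F / p.2%:F.
Proof.
elim/quotW: x => r; exists (\n_r, \d_r); split; first exact: denom_ratioP.
apply/esym/(canLR (mulfK _)); first by rewrite tofrac_eq0 denom_ratioP.
rewrite !tofrac_pi -[RHS](FracField.pi_mul r).
apply/eqmodP; rewrite /= FracField.equivfE /FracField.mulf.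
by rewrite !numden_Ratio ?mulf_neq0 ?oner_neq0 ?denom_ratioP //; apply/eqP; ring.
Qed.

(** Clears denominators in a linear relation over the field of fractions, so
that it becomes a relation over the domain. *)
Lemma common_denominator (I : finType) (x : I -> {fraction D}) :
  exists (d : D) (c : I -> D),
    d != 0 /\ forall i, d%:F * x i = (c i)%:F.
Proof.
have [p pE] := choice (fun i => tofrac_denom (x i)).
exists (\prod_i (p i).2), (fun i => (p i).1 * \prod_(j | j != i) (p j).2).
split=> [|i]; first by apply/prodf_neq0 => i _; have [] := pE i.
have [pi0 ->] := pE i.
by rewrite (bigD1 i) //= !tofracM mulrC mulrA mulfVK ?tofrac_eq0.
Qed.

Lemma natural_basis_incl (mu : {bilinear E -> E -> E}) (I : finType)
    (e : I -> E) :
  natural_basis mu e -> natural_basis (fracmul mu) (fun i => incl (e i)).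
Proof.
move=> [[e_span e_free] e_orth]; split; last first.
  move=> i j ij; rewrite [LHS]fracmulE e_orth // -incl0.
  by apply: mfrac_eq; rewrite !scaler0.
split=> [|x x0 i].
  elim/mfrac_elim=> a d; have [c ->] := e_span a.
  exists (fun i => (sval d)%:F^-1 * (c i)%:F).
  rewrite mfracE incl_sum scaler_sumr.
  by apply: eq_bigr => i _; rewrite scalerA.
have [d [c [d0 dxE]]] := common_denominator x.
have /incl_eq0[s s0] : incl (\sum_i c i *: e i) = 0.
  rewrite incl_sum; under eq_bigr => j _ do rewrite -dxE -scalerA.
  by rewrite -scaler_sumr x0 scaler0.
rewrite scaler_sumr; under eq_bigr do rewrite scalerA.
move=> /(e_free (fun i => s * c i))/(_ i)/eqP; rewrite mulf_eq0 (negPf s0) /=.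
rewrite -tofrac_eq0 -dxE mulf_eq0 tofrac_eq0 (negPf d0) /=.
by move/eqP.
Qed.

Lemma structure_constants_incl (mu : {bilinear E -> E -> E}) (I : finType)
    (e : I -> E) (w : I -> I -> D) :
  structure_constants mu e w ->
  structure_constants (fracmul mu) (fun i => incl (e i))
    (fun i j => (w i j)%:F).
Proof.
move=> hw i; rewrite [LHS]fracmulE -incl_sum -hw; apply: mfrac_eq.
by rewrite /= mulr1.
Qed.

End Fractions.

(** Quasiperfection is fullness of the square of the scalar extension, and the
determinant commutes with the embedding in the field of fractions, where
every nonzero element is a unit. *)
Lemma quasiperfect_det (D : idomainType) (E : lmodType D)
    (mu : {bilinear E -> E -> E}) (I : finType) (e : I -> E)
    (w : I -> I -> D) :
  natural_basis mu e -> structure_constants mu e w ->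
  quasiperfect mu <-> \det (matrix_of_family w) != 0.
Proof.
move=> he hw.
rewrite /quasiperfect (square_full_unitmx (natural_basis_incl he)
  (structure_constants_incl hw)).
by rewrite -map_matrix_of_family unitmxE det_map_mx unitfE tofrac_eq0.
Qed.

Theorem proposition2 (D : idomainType) (E : lmodType D)
    (mu : {bilinear E -> E -> E}) (I : finType) (e : I -> E)
    (he : natural_basis mu e)
    (w : I -> I -> D) (hw : structure_constants mu e w) :
  ((square_full mu <-> matrix_of_family w \in unitmx) /\
   (square_full mu ->
    forall f : I -> E, natural_basis mu f ->
    exists (s : {perm I}) (k : I -> D),
      forall i, k i \is a GRing.unit /\ f i = k i *: e (s i))) /\
  ((quasiperfect mu <-> \det (matrix_of_family w) != 0) /\
   (quasiperfect mu ->
    forall f : I -> E, natural_basis mu f ->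
    exists (s : {perm I}) (k : I -> D),
      forall i, k i \is a GRing.unit /\ f i = k i *: e (s i))).
Proof.
have unitE := square_full_unitmx he hw; have detE := quasiperfect_det he hw.
split; split=> //.
- move=> /unitE; rewrite unitmxE => wU f.
  by apply: natural_basis_unique he hw _; apply: contraTneq wU => ->; rewrite unitr0.
- by move=> /detE dw f; apply: natural_basis_unique he hw dw.
Qed.
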